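(* Let $m<n$ be positive integers, $\bm{A}\in\mathbb{R}^{m\times n}$, $\bm{x}\in\mathbb{R}^n$, $\eta_2\ge 0$, and let $\bm{b}=\bm{A}\bm{x}+\bm{z}$ with $\bm{z}\in\mathbb{R}^m$, $\|\bm{A}^*\bm{z}\|_\infty\le\eta_2$. Let $s\in\{1,\dots,n\}$, $0<\alpha\le 1$, and let $k>0$ be such that $ks$ is a positive integer. Put $$a:=a(s,ks;\alpha)=\frac{\sqrt{ks}-\alpha}{\sqrt{s}+\alpha},\qquad b_0:=b(s,k;\alpha)=\frac{8(2\sqrt{ks}-\alpha)}{17\alpha(2\sqrt{k}+1)},$$ and assume $a>2$, $b_0>1$ and $a\,b_0<a+b_0$. Let $\hat{\bm{x}}^{DS}$ be the minimizer of $$\min_{\bm{u}\in\mathbb{R}^n}\ \|\bm{u}\|_1-\alpha\|\bm{u}\|_2\quad\text{subject to}\quad\|\bm{A}^*(\bm{b}-\bm{A}\bm{u})\|_\infty\le\eta_2.$$ If the $(\ell_2,\ell_1)$ restricted isometry constants of $\bm{A}$ satisfy $$(b_0+1)\,\delta_{ks}^{ub}+a\,b_0\,\delta_{(k+1)s}^{lb}<a\,b_0-b_0-1,$$ then $$\|\hat{\bm{x}}^{DS}-\bm{x}\|_2\le\frac{\sqrt{s}\,\varrho}{\sqrt{s}-\alpha\varrho}\cdot\frac{2\|\bm{x}_{-\max(s)}\|_1}{\sqrt{s}}+\frac{2(2\sqrt{k}+1)\big((1+\delta_{ks}^{ub})+a\,\rho_{ks}\big)\,m\,s}{\sqrt{k}\,(\sqrt{s}-\alpha\varrho)(1+\delta_{ks}^{ub})\rho_{ks}^2}\,\eta_2,$$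 where $$\rho_{ks}=1-\delta_{(k+1)s}^{lb}-\frac{1+\delta_{ks}^{ub}}{a},\qquad \varrho=\frac{1}{2\sqrt{k}}\left(\frac{17(2\sqrt{k}+1)(1+\delta_{ks}^{ub})}{16\,a\,\rho_{ks}}+1\right).$$
   Context: $\bm{A}^*$ denotes the transpose of $\bm{A}$. A vector is $r$-sparse if it has at most $r$ nonzero coordinates. For a matrix $\bm{A}\in\mathbb{R}^{m\times n}$ and a positive integer $r$, the $(\ell_2,\ell_1)$ restricted isometry constants $\delta_r^{lb}$ and $\delta_r^{ub}$ of order $r$ are the smallest numbers such that $$(1-\delta_r^{lb})\|\bm{u}\|_2\le\|\bm{A}\bm{u}\|_1\le(1+\delta_r^{ub})\|\bm{u}\|_2$$ for all $r$-sparse $\bm{u}\in\mathbb{R}^n$. For $\bm{x}\in\mathbb{R}^n$, $\bm{x}_{\max(s)}$ denotes $\bm{x}$ with all but its $s$ largest entries in absolute value set to zero, and $\bm{x}_{-\max(s)}=\bm{x}-\bm{x}_{\max(s)}$. *)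

(* Defs.v *)
From mathcomp Require Import all_boot all_order all_algebra.
From mathcomp Require Import all_classical reals topology normedtype.

Set Implicit Arguments.
Unset Strict Implicit.
Unset Printing Implicit Defensive.

Import Order.TTheory GRing.Theory Num.Theory.
Import numFieldNormedType.Exports.

Local Open Scope classical_set_scope.
Local Open Scope ring_scope.

(* Vectors are columns.  The library norm [`|v|] of a matrix is already the
   maximum of the absolute values of its entries, i.e. the l_oo norm of a
   vector. *)

Definition norm1 (R : realType) (n : nat) (v : 'cV[R]_n) : R :=
  \sum_i `|v i 0|.

Definition norm2 (R : realType) (n : nat) (v : 'cV[R]_n) : R :=
  Num.sqrt (\sum_i v i 0 ^+ 2).

Definition sparse (R : realType) (n r : nat) (u : 'cV[R]_n) : Prop :=
  (#|[set i | (u i 0 != 0)%R]%SET| <= r)%N.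

Definition rip_lower (R : realType) (m n : nat) (A : 'M[R]_(m, n)) (r : nat)
    : set R :=
  [set d | forall u : 'cV[R]_n, sparse r u ->
             (1 - d) * norm2 u <= norm1 (A *m u)].

Definition rip_upper (R : realType) (m n : nat) (A : 'M[R]_(m, n)) (r : nat)
    : set R :=
  [set d | forall u : 'cV[R]_n, sparse r u ->
             norm1 (A *m u) <= (1 + d) * norm2 u].

(* For n, r > 0 these infima are minima: see [delta_lb_least] and
   [delta_ub_least]. *)
Definition delta_lb (R : realType) (m n : nat) (A : 'M[R]_(m, n)) (r : nat)
  : R := inf (rip_lower A r).

Definition delta_ub (R : realType) (m n : nat) (A : 'M[R]_(m, n)) (r : nat)
  : R := inf (rip_upper A r).

(* Number of coordinates that precede i when the coordinates of x are listed
   by decreasing absolute value, ties being broken by increasing index. *)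
Definition mag_rank (R : realType) (n : nat) (x : 'cV[R]_n) (i : 'I_n) : nat :=
  #|[set j : 'I_n | (`|x i 0| < `|x j 0|)
                 || ((`|x j 0| == `|x i 0|) && (j < i)%N)]%SET|.

Definition max_part (R : realType) (n s : nat) (x : 'cV[R]_n) : 'cV[R]_n :=
  \col_i (if (mag_rank x i < s)%N then x i 0 else 0).

Definition tail_part (R : realType) (n s : nat) (x : 'cV[R]_n) : 'cV[R]_n :=
  x - max_part s x.

Definition ds_feasible (R : realType) (m n : nat) (A : 'M[R]_(m, n))
    (b : 'cV[R]_m) (eta : R) (u : 'cV[R]_n) : Prop :=
  `|A^T *m (b - A *m u)| <= eta.

Definition ds_minimizer (R : realType) (m n : nat) (A : 'M[R]_(m, n))
    (b : 'cV[R]_m) (eta alpha : R) (xhat : 'cV[R]_n) : Prop :=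
  ds_feasible A b eta xhat /\
  forall u : 'cV[R]_n, ds_feasible A b eta u ->
    norm1 xhat - alpha * norm2 xhat <= norm1 u - alpha * norm2 u.

(* The second argument stands for the product ks. *)
Definition par_a (R : realType) (s ks alpha : R) : R :=
  (Num.sqrt ks - alpha) / (Num.sqrt s + alpha).

Definition par_b (R : realType) (s k alpha : R) : R :=
  (8 * (2 * Num.sqrt (k * s) - alpha)) /
  (17 * alpha * (2 * Num.sqrt k + 1)).

Section Sanity.
Variable R : realType.

Lemma norm1_ge0 n (v : 'cV[R]_n) : 0 <= norm1 v.
Proof. by apply: sumr_ge0. Qed.

Lemma norm2_ge0 n (v : 'cV[R]_n) : 0 <= norm2 v.
Proof. exact: sqrtr_ge0. Qed.

Lemma normc_le_norm2 n (v : 'cV[R]_n) i : `|v i 0| <= norm2 v.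
Proof.
rewrite -sqrtr_sqr ler_wsqrtr// (bigD1 i)//= lerDl.
by apply: sumr_ge0 => j _; exact: sqr_ge0.
Qed.

Lemma norm2_eq0 n (v : 'cV[R]_n) : norm2 v = 0 -> v = 0.
Proof.
move=> v0; apply/colP => i; rewrite mxE; apply/eqP.
by rewrite -normr_le0 -v0 normc_le_norm2.
Qed.

Lemma norm1_0 n : norm1 (0 : 'cV[R]_n) = 0.
Proof. by rewrite /norm1 big1// => i _; rewrite mxE normr0. Qed.

Lemma sparse_unit n (i : 'I_n) r : (0 < r)%N ->
  exists2 e : 'cV[R]_n, sparse r e & norm2 e = 1.
Proof.
move=> r0; exists (delta_mx i 0).
  apply: leq_trans r0; rewrite -[X in (_ <= X)%N](cards1 i).
  apply: subset_leq_card.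
  by apply/fintype.subsetP => j; rewrite !inE mxE andbT; case: (j == i); rewrite ?eqxx.
rewrite /norm2 (bigD1 i)//= big1 ?mxE ?eqxx ?addr0 ?expr1n ?sqrtr1// => j ji.
by rewrite mxE (negbTE ji) expr0n.
Qed.

Lemma norm1_mul_bounded m n (A : 'M[R]_(m, n)) :
  exists C, forall u, norm1 (A *m u) <= C * norm2 u.
Proof.
exists (\sum_i \sum_j `|A i j|) => u.
rewrite mulr_suml; apply: ler_sum => i _; rewrite mxE mulr_suml.
apply: le_trans (ler_norm_sum _ _ _) _; apply: ler_sum => j _.
by rewrite normrM ler_wpM2l// normc_le_norm2.
Qed.

Lemma delta_lb_least m n (A : 'M[R]_(m, n)) r : (0 < n)%N -> (0 < r)%N ->
  rip_lower A r (delta_lb A r) /\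
  (forall d, rip_lower A r d -> delta_lb A r <= d).
Proof.
move=> n0 r0.
have ne : nonempty (rip_lower A r).
  by exists 1 => u _; rewrite subrr mul0r norm1_ge0.
have lb : has_lbound (rip_lower A r).
  have [e es e1] := sparse_unit (Ordinal n0) r0.
  exists (1 - norm1 (A *m e)) => d /(_ e es).
  by rewrite e1 mulr1 !lerBlDr addrC.
split; last by move=> d; exact: ge_inf.
move=> u us; have [u0|u0] := eqVneq (norm2 u) 0.
  by rewrite u0 mulr0 norm1_ge0.
have u_gt0 : 0 < norm2 u by rewrite lt_def u0 norm2_ge0.
rewrite -ler_pdivlMr// lerBlDr -lerBlDl; apply: lb_le_inf => // d /(_ u us).
by rewrite -ler_pdivlMr// lerBlDr -lerBlDl.
Qed.

Lemma delta_ub_least m n (A : 'M[R]_(m, n)) r : (0 < n)%N -> (0 < r)%N ->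
  rip_upper A r (delta_ub A r) /\
  (forall d, rip_upper A r d -> delta_ub A r <= d).
Proof.
move=> n0 r0.
have ne : nonempty (rip_upper A r).
  have [C hC] := norm1_mul_bounded A.
  by exists (C - 1) => u _; rewrite addrC subrK.
have lb : has_lbound (rip_upper A r).
  have [e es e1] := sparse_unit (Ordinal n0) r0.
  exists (norm1 (A *m e) - 1) => d /(_ e es).
  by rewrite e1 mulr1 lerBlDl.
split; last by move=> d; exact: ge_inf.
move=> u us; have [u0|u0] := eqVneq (norm2 u) 0.
  by rewrite u0 mulr0 (norm2_eq0 u0) mulmx0 norm1_0.
have u_gt0 : 0 < norm2 u by rewrite lt_def u0 norm2_ge0.
rewrite -ler_pdivrMr// -lerBlDl; apply: lb_le_inf => // d /(_ u us).
by rewrite -ler_pdivrMr// -lerBlDl.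
Qed.

End Sanity.

(* Main.v *)
Require Import Defs.
From mathcomp Require Import all_boot all_order all_algebra.
From mathcomp Require Import all_classical reals topology normedtype.
From mathcomp Require Import ring lra.
Import Order.TTheory GRing.Theory Num.Theory.
Import numFieldNormedType.Exports.
Local Open Scope ring_scope.

(** Put h = xhat - x, let T carry the s largest coordinates of x, let B carry
the ks largest coordinates of h outside T, and write q = sqrt k, S = sqrt s,
u for the l2 norm of h on T and B together, N for the l1 norm of h off T, and
E = (2 * norm1 (tail_part s x) + alpha * norm2 h) / S.  Five facts hold.

- Cone: x is feasible, so minimality of xhat and the two triangle inequalities
  give N <= S * u + S * E ([l1_l2_cone]).
- Residual: both x and xhat are feasible, so A^T A h is at most 2 eta in
  sup norm; pairing it with h bounds the square of norm2 (A h) by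
  2 eta * norm1 h ([ds_residual], [norm2_mul_sqr_le]), and
  norm1 (A h) <= sqrt m * norm2 (A h).
- Shelling: cutting h off T and B into blocks of ks coordinates of decreasing
  magnitude shows that A maps this tail to a vector of l1 norm at most
  (1 + dub) * N / (q * S) ([exists_head_small_tail]).
- Tail energy: the l2 norm of the same tail is at most N / (2 * q * S).
- Lower isometry on T and B:
  (1 - dlb) * u <= norm1 (A h) + (1 + dub) * N / (q * S).

The rest is arithmetic in the scalars ([recovery_error_bound]).  With
D = 1 + dub and w = D / (a * rho), the last fact would read
u <= norm1 (A h) / rho + w * E if 1 / q were replaced by the larger number
1 / a.  That form is too weak: norm1 (A h) is itself of the order of
sqrt (2 u + E), and absorbing the square root into 17/16 * w * E plus a
multiple of eta takes more room than the factor 17/16 offers.  The room comes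
from the conditions on the parameters.  From 2 < a and a * b0 < a + b0 follows
b0 < 2, and this keeps alpha / S above 16/89; hence a, which is smaller than q
precisely because of alpha, satisfies a <= 9/10 * q ([par_a_le]).  Thus
(1 + w / 10) * u <= norm1 (A h) / rho + 9/10 * w * E, and an
arithmetic-geometric mean inequality with a suitable weight gives
u <= 17/16 * w * E + const * eta ([quadratic_head_bound]).  Adding the tail
energy gives norm2 h <= varrho * E + const * eta.  Since E contains
alpha * norm2 h / S, it remains to solve for norm2 h, which is possible because
the isometry condition says w < b0, and b0 is defined so that this implies
alpha * varrho < S. *)

Set Implicit Arguments.
Unset Strict Implicit.
Unset Printing Implicit Defensive.

(** * Norm inequalities *)

Section Norms.
Context (R : realType).

(** Lagrange's identity: the difference of the two sides is half the sum of the
squared 2 x 2 minors of the pair f, g. *)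
Lemma cauchy_schwarz_sum (I : finType) (f g : I -> R) :
  (\sum_i f i * g i) ^+ 2 <= (\sum_i f i ^+ 2) * (\sum_i g i ^+ 2).
Proof.
suff -> : (\sum_i f i ^+ 2) * (\sum_i g i ^+ 2) = (\sum_i f i * g i) ^+ 2
    + (\sum_i \sum_j (f i * g j - f j * g i) ^+ 2) / 2.
  by rewrite lerDl divr_ge0//; do 2!apply: sumr_ge0 => ? _; exact: sqr_ge0.
have e : \sum_i \sum_j (f i * g j - f j * g i) ^+ 2 =
    \sum_i \sum_j (f i ^+ 2 * g j ^+ 2) + \sum_i \sum_j (f j ^+ 2 * g i ^+ 2)
    - 2 * \sum_i \sum_j (f i * g i) * (f j * g j).
  rewrite mulr_sumr -sumrN -!big_split/=; apply: eq_bigr => i _.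
  rewrite mulr_sumr -sumrN -!big_split/=; apply: eq_bigr => j _; ring.
rewrite e [X in _ + X - _]exchange_big/= -!big_distrlr/=; by field.
Qed.

Lemma norm2_sqr n (v : 'cV[R]_n) : norm2 v ^+ 2 = \sum_i v i 0 ^+ 2.
Proof. by rewrite sqr_sqrtr// sumr_ge0// => i _; exact: sqr_ge0. Qed.

Lemma norm2_triangle n (u v : 'cV[R]_n) : norm2 (u + v) <= norm2 u + norm2 v.
Proof.
rewrite -(@ler_pXn2r _ 2)// ?nnegrE ?addr_ge0 ?norm2_ge0//.
have cs : \sum_i u i 0 * v i 0 <= norm2 u * norm2 v.
  apply: le_trans (ler_norm _) _.
  rewrite -(@ler_pXn2r _ 2)// ?nnegrE ?mulr_ge0 ?norm2_ge0//.
  by rewrite real_normK ?num_real// exprMn !norm2_sqr cauchy_schwarz_sum.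
rewrite sqrrD !norm2_sqr.
have -> : \sum_i (u + v) i 0 ^+ 2 = \sum_i u i 0 ^+ 2 +
    (\sum_i u i 0 * v i 0) *+ 2 + \sum_i v i 0 ^+ 2.
  rewrite -sumrMnl -!big_split/=; apply: eq_bigr => i _.
  by rewrite mxE sqrrD.
by rewrite lerD2r lerD2l lerMn2r.
Qed.

Lemma norm1_triangle n (u v : 'cV[R]_n) : norm1 (u + v) <= norm1 u + norm1 v.
Proof.
by rewrite -big_split/=; apply: ler_sum => i _; rewrite mxE ler_normD.
Qed.

Lemma norm1N n (u : 'cV[R]_n) : norm1 (- u) = norm1 u.
Proof. by apply: eq_bigr => i _; rewrite mxE normrN. Qed.

(** Cauchy-Schwarz against the indicator of the support. *)
Lemma sparse_norm1_le n r (v : 'cV[R]_n) : sparse r v ->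
  norm1 v <= Num.sqrt r%:R * norm2 v.
Proof.
move=> vr; rewrite -(@ler_pXn2r _ 2)// ?nnegrE ?mulr_ge0 ?sqrtr_ge0 ?norm2_ge0 ?norm1_ge0//.
rewrite exprMn sqr_sqrtr// norm2_sqr.
pose g i : R := (v i 0 != 0)%:R.
have -> : norm1 v = \sum_i g i * `|v i 0|.
  apply: eq_bigr => i _; rewrite /g; case: eqP => [->|_]; last by rewrite mul1r.
  by rewrite normr0 mul0r.
apply: le_trans (cauchy_schwarz_sum g (fun i => `|v i 0|)) _.
have -> : \sum_i `|v i 0| ^+ 2 = \sum_i v i 0 ^+ 2.
  by apply: eq_bigr => i _; rewrite real_normK ?num_real.
rewrite ler_wpM2r//; first by apply: sumr_ge0 => i _; exact: sqr_ge0.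
have -> : \sum_i g i ^+ 2 = (#|[set i | (v i 0 != 0)%R]%SET|)%:R.
  rewrite -sum1_card natr_sum [RHS]big_mkcond/=; apply: eq_bigr => i _.
  by rewrite inE /g; case: (_ != _); rewrite ?expr1n ?expr0n.
by rewrite ler_nat.
Qed.

Lemma norm1_le_sqrt_dim n (v : 'cV[R]_n) : norm1 v <= Num.sqrt n%:R * norm2 v.
Proof.
by apply: sparse_norm1_le; rewrite /sparse -[X in (_ <= X)%N]card_ord max_card.
Qed.

Lemma mx_entry_le_norm n (v : 'cV[R]_n) i : `|v i 0| <= `|v|.
Proof.
rewrite [leRHS]/Num.Def.normr/= mx_normrE.
by apply: (le_bigmax _ (fun ij : 'I_n * 'I_1 => `|v ij.1 ij.2|) (i, 0)).
Qed.

(** The square on the left is the pairing of A^T A h with h, to which the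
sup-norm / l1 duality applies. *)
Lemma norm2_mul_sqr_le m n (A : 'M[R]_(m, n)) (h : 'cV[R]_n) :
  norm2 (A *m h) ^+ 2 <= `|A^T *m (A *m h)| * norm1 h.
Proof.
have -> : norm2 (A *m h) ^+ 2 = \sum_j (A^T *m (A *m h)) j 0 * h j 0.
  rewrite norm2_sqr.
  under eq_bigr => i _ do rewrite expr2 {2}mxE mulr_sumr.
  rewrite exchange_big/=; apply: eq_bigr => j _.
  rewrite [X in _ = X * _]mxE mulr_suml; apply: eq_bigr => i _.
  by rewrite [A^T j i]mxE; ring.
rewrite mulr_sumr; apply: ler_sum => j _.
apply: le_trans (ler_norm _) _.
by rewrite normrM ler_wpM2r// mx_entry_le_norm.
Qed.

End Norms.

(** * Restriction of a vector to a set of coordinates *)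

Section Restriction.
Context (R : realType) (n : nat).
Implicit Types (v : 'cV[R]_n) (S B : {set 'I_n}).

Definition restr S v : 'cV[R]_n := \col_i (if i \in S then v i 0 else 0).

Lemma norm1_restr S v : norm1 (restr S v) = \sum_(i in S) `|v i 0|.
Proof.
rewrite [RHS]big_mkcond/=; apply: eq_bigr => i _.
by rewrite mxE; case: ifP; rewrite ?normr0.
Qed.

Lemma norm2_restr_sqr S v : norm2 (restr S v) ^+ 2 = \sum_(i in S) v i 0 ^+ 2.
Proof.
rewrite norm2_sqr [RHS]big_mkcond/=; apply: eq_bigr => i _.
by rewrite mxE; case: ifP; rewrite ?expr0n.
Qed.

Lemma sparse_restr S v r : (#|S| <= r)%N -> sparse r (restr S v).
Proof.
apply: leq_trans; apply/subset_leq_card/fintype.subsetP => i.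
by rewrite inE mxE; case: ifP; rewrite ?eqxx.
Qed.

Lemma restr_split B S v : B \subset S ->
  restr S v = restr B v + restr (S :\: B) v.
Proof.
move=> /fintype.subsetP BS; apply/colP => i; rewrite !mxE inE.
case: (boolP (i \in B)) => [/BS ->|_]/=; first by rewrite addr0.
by rewrite add0r.
Qed.

Lemma norm1_restr_split B S v : B \subset S ->
  norm1 (restr S v) = norm1 (restr B v) + norm1 (restr (S :\: B) v).
Proof.
move=> BS; rewrite !norm1_restr (big_setID B)/=; congr (_ + _).
by move/finset.setIidPr : BS => ->.
Qed.

Lemma restr_setT v : restr [set: 'I_n]%SET v = v.
Proof. by apply/colP => i; rewrite mxE inE. Qed.

Lemma restr_splitC S v : v = restr S v + restr (~: S) v.
Proof.
by rewrite -[LHS]restr_setT (restr_split v (finset.subsetT S)) finset.setTD.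
Qed.

Lemma norm2_restr_subset B S v : B \subset S ->
  norm2 (restr B v) <= norm2 (restr S v).
Proof.
move=> BS; rewrite -(@ler_pXn2r _ 2)// ?nnegrE ?norm2_ge0//.
rewrite !norm2_restr_sqr [leRHS](big_setID B)/=.
move/finset.setIidPr : BS => ->; rewrite lerDl.
by apply: sumr_ge0 => i _; exact: sqr_ge0.
Qed.

Lemma norm2_restr_le S v r tau : (#|S| <= r)%N -> 0 <= tau ->
  {in S, forall i, `|v i 0| <= tau} -> norm2 (restr S v) <= Num.sqrt r%:R * tau.
Proof.
move=> Sr t0 vt; rewrite -(@ler_pXn2r _ 2)// ?nnegrE ?norm2_ge0 ?mulr_ge0 ?sqrtr_ge0//.
rewrite norm2_restr_sqr exprMn sqr_sqrtr//.
apply: (@le_trans _ _ (\sum_(i in S) tau ^+ 2)).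
  apply: ler_sum => i /vt vi.
  by rewrite -[leLHS]real_normK ?num_real// lerXn2r ?nnegrE.
by rewrite sumr_const -[leLHS]mulr_natl ler_wpM2r ?sqr_ge0// ler_nat.
Qed.

Lemma card_mul_le_norm1_restr S v tau :
  {in S, forall i, tau <= `|v i 0|} -> #|S|%:R * tau <= norm1 (restr S v).
Proof.
move=> vt; rewrite norm1_restr mulr_natl -sumr_const.
by apply: ler_sum => i /vt.
Qed.

(** The K largest entries of v on S, with a threshold tau that separates them
from the other entries.  The cardinal is a minimum so that the case where S has
fewer than K elements needs no separate statement. *)
Lemma exists_largest_entries S v K : exists B tau,
  [/\ B \subset S, #|B| = minn K #|S|, 0 <= tau,
      {in B, forall i, tau <= `|v i 0|} &
      {in S :\: B, forall i, `|v i 0| <= tau}].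
Proof.
elim: K => [|K [B [tau [BS Bc t0 tB tSB]]]].
  (* No entry exceeds the l2 norm, which therefore separates the empty set. *)
  exists finset.set0, (norm2 v); split; rewrite ?finset.sub0set ?cards0 ?min0n ?norm2_ge0//.
    by move=> i; rewrite inE.
  by move=> i _; exact: normc_le_norm2.
have [SK|KS] := leqP #|S| K.
  exists B, tau; split=> //; rewrite Bc.
  by rewrite (minn_idPr SK) (minn_idPr (leqW SK)).
have cB : #|B| = K by rewrite Bc (minn_idPl (ltnW KS)).
have /finset.set0Pn[i0 i0SB] : (S :\: B)%SET != finset.set0.
  by rewrite -cards_eq0 cardsD (finset.setIidPr BS) cB subn_eq0 -ltnNge.
case: (@Order.TotalTheory.arg_maxP _ _ _ i0 (mem (S :\: B)) (fun i => `|v i 0|) i0SB).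
move=> i iSB' imax; have iSB : i \in (S :\: B)%SET by exact: iSB'.
exists (i |: B)%SET, `|v i 0|; split=> //.
- rewrite finset.subUset BS andbT finset.sub1set.
  by move: iSB; rewrite inE => /andP[].
- rewrite cardsU1 cB (minn_idPl KS); move: iSB; rewrite !inE => /andP[->] _.
  by rewrite add1n.
- move=> j; rewrite !inE => /orP[/eqP->//|jB].
  exact: le_trans (tSB _ iSB) (tB _ jB).
- move=> j; rewrite !inE negb_or -andbA => /and3P[_ jB jS].
  have jSB : j \in (S :\: B)%SET by rewrite inE jB jS.
  exact: imax jSB.
Qed.

End Restriction.

(** * Block decomposition by decreasing magnitude *)

Section Shelling.
Context (R : realType) (m n : nat).
Variables (A : 'M[R]_(m, n)) (K : nat) (D : R).
Hypotheses (K0 : (0 < K)%N) (D0 : 0 <= D).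
Hypothesis AD : forall u, sparse K u -> norm1 (A *m u) <= D * norm2 u.

Let q := Num.sqrt (K%:R : R).
Let q0 : 0 < q. Proof. by rewrite sqrtr_gt0 ltr0n. Qed.
Let qq : q * q = K%:R. Proof. by rewrite -expr2 sqr_sqrtr. Qed.

(** The shelling argument as an induction on S.  Peel off the K largest entries
on S: this block is sparse and has l2 norm at most q * tau, while each of its K
entries dominates the threshold tau' of what remains, so q * tau' is at most the
l1 norm of the block over q.  The term q * tau' of the next step is thus paid
by the l1 mass of the block removed in this one. *)
Lemma norm1_mul_restr_le_bounded (S : {set 'I_n}) (v : 'cV[R]_n) (tau : R) :
  0 <= tau -> {in S, forall i, `|v i 0| <= tau} ->
  norm1 (A *m restr S v) <= D * (q * tau + norm1 (restr S v) / q).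
Proof.
move: {2}#|S|.+1 (ltnSn #|S|) tau => N; elim: N S => // N IH S SN tau t0 vt.
have [SK|KS] := leqP #|S| K.
  apply: le_trans (AD (sparse_restr v SK)) _; rewrite ler_wpM2l//.
  apply: le_trans (norm2_restr_le SK t0 vt) _.
  by rewrite lerDl divr_ge0 ?norm1_ge0 ?ltW.
have [B [tau' [BS Bc t0' tB tSB]]] := exists_largest_entries S v K.
have cB : #|B| = K by rewrite Bc (minn_idPl (ltnW KS)).
have tail : norm1 (A *m restr (S :\: B) v) <=
    D * (q * tau' + norm1 (restr (S :\: B) v) / q).
  apply: IH => //; rewrite cardsD (finset.setIidPr BS) cB.
  by rewrite -ltnS; apply: leq_trans SN; rewrite ltnS ltn_subrL K0 (leq_trans K0 (ltnW KS)).
have head : norm1 (A *m restr B v) <= D * (q * tau).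
  apply: le_trans (AD (sparse_restr v _)) _; first by rewrite cB.
  rewrite ler_wpM2l//; apply: norm2_restr_le => //; first by rewrite cB.
  by move=> i /(fintype.subsetP BS)/vt.
have shift : q * tau' <= norm1 (restr B v) / q.
  rewrite ler_pdivlMr// mulrAC qq -cB.
  exact: card_mul_le_norm1_restr.
rewrite (restr_split v BS) mulmxDr -(restr_split v BS) (norm1_restr_split v BS).
apply: le_trans (norm1_triangle _ _) _.
apply: le_trans (lerD head tail) _.
rewrite -mulrDr ler_wpM2l// mulrDl lerD2l lerD2r//.
Qed.

(** B holds the K largest entries on S.  The image of the tail is bounded by
shelling, the initial term q * tau being paid by the mass of B.  For the l2
bound, with N the l1 norm of the tail, the squared norm of the tail is at most
tau * N, while q^2 * tau is at most the mass of B; since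
4 * (q^2 * tau) * N <= (q^2 * tau + N)^2, this gives the factor 1/2. *)
Lemma exists_head_small_tail (S : {set 'I_n}) (v : 'cV[R]_n) : exists B : {set 'I_n},
  [/\ B \subset S, (#|B| <= K)%N,
      norm2 (restr (S :\: B) v) <= norm1 (restr S v) / (2 * q) &
      norm1 (A *m restr (S :\: B) v) <= D * (norm1 (restr S v) / q)].
Proof.
have [B [tau [BS Bc t0 tB tSB]]] := exists_largest_entries S v K.
exists B; split => //; first by rewrite Bc geq_minl.
  have [SK|KS] := leqP #|S| K.
    have -> : norm2 (restr (S :\: B) v) = 0.
      apply/eqP; rewrite -sqrf_eq0 norm2_restr_sqr.
      have /eqP -> : (S :\: B)%SET == finset.set0.
        by rewrite -cards_eq0 cardsD (finset.setIidPr BS) Bc (minn_idPr SK) subnn.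
      by rewrite big_set0.
    by rewrite divr_ge0 ?norm1_ge0// mulr_ge0// ltW.
  have KB : q ^+ 2 * tau <= norm1 (restr B v).
    rewrite sqr_sqrtr//; have -> : K = #|B| by rewrite Bc (minn_idPl (ltnW KS)).
    exact: card_mul_le_norm1_restr.
  rewrite (norm1_restr_split v BS); set N := norm1 (restr (S :\: B) v).
  have N0 : 0 <= N := norm1_ge0 _.
  have T2 : norm2 (restr (S :\: B) v) ^+ 2 <= tau * N.
    rewrite norm2_restr_sqr /N norm1_restr mulr_sumr; apply: ler_sum => i /tSB vi.
    by rewrite -[leLHS]real_normK ?num_real// expr2 ler_wpM2r.
  have q2 : 0 < 2 * q by rewrite mulr_gt0.
  rewrite -(@ler_pXn2r _ 2)// ?nnegrE ?norm2_ge0 ?divr_ge0 ?addr_ge0 ?norm1_ge0 ?(ltW q2)//.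
  apply: le_trans T2 _; rewrite expr_div_n ler_pdivlMr ?exprn_gt0//.
  apply: (@le_trans _ _ ((q ^+ 2 * tau + N) ^+ 2)).
    rewrite -subr_ge0; have -> : (q ^+ 2 * tau + N) ^+ 2 - tau * N * (2 * q) ^+ 2
      = (q ^+ 2 * tau - N) ^+ 2 by ring.
    exact: sqr_ge0.
  have qt0 : 0 <= q ^+ 2 * tau by rewrite mulr_ge0// sqr_ge0.
  apply: lerXn2r; rewrite ?nnegrE ?lerD2r//; first exact: addr_ge0.
  by rewrite addr_ge0// norm1_ge0.
have [SK|KS] := leqP #|S| K.
  have -> : restr (S :\: B) v = 0.
    have /eqP -> : (S :\: B)%SET == finset.set0.
      by rewrite -cards_eq0 cardsD (finset.setIidPr BS) Bc (minn_idPr SK) subnn.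
    by apply/colP => i; rewrite !mxE inE.
  by rewrite mulmx0 norm1_0 mulr_ge0// divr_ge0 ?norm1_ge0 ?ltW.
apply: le_trans (norm1_mul_restr_le_bounded t0 tSB) _.
rewrite ler_wpM2l// (norm1_restr_split v BS) mulrDl lerD2r ler_pdivlMr// mulrAC qq.
have -> : K = #|B| by rewrite Bc (minn_idPl (ltnW KS)).
exact: card_mul_le_norm1_restr.
Qed.

End Shelling.

(** * The support of the largest coordinates *)

Section LargestCoordinates.
Context (R : realType) (n : nat).

(** The order behind [mag_rank] is a strict total order, and the set of
predecessors grows strictly along it. *)
Lemma mag_rank_inj (x : 'cV[R]_n) : injective (mag_rank x).
Proof.
pose before (j i : 'I_n) := (`|x i 0| < `|x j 0|)
  || ((`|x j 0| == `|x i 0|) && (j < i)%N).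
have btrans i j l : before i j -> before j l -> before i l.
  rewrite /before => /orP[ij|/andP[/eqP ij lij]] /orP[jl|/andP[/eqP jl ljl]].
  - by rewrite (lt_trans jl ij).
  - by rewrite -jl ij.
  - by rewrite ij jl.
  - by rewrite ij jl eqxx (ltn_trans lij ljl) orbT.
have birr i : ~~ before i i by rewrite /before ltxx ltnn andbF.
have rank_lt i j : before i j -> (mag_rank x i < mag_rank x j)%N.
  move=> ij; apply: proper_card; apply/fintype.properP; split.
    by apply/fintype.subsetP => l; rewrite !inE => /btrans /(_ ij).
  by exists i; rewrite inE//; exact: birr.
move=> i j; have [//|ij] := eqVneq i j.
suff /orP[] : before i j || before j i.
- by move=> /rank_lt + e; rewrite e ltnn.
- by move=> /rank_lt + e; rewrite e ltnn.
rewrite /before; case: (ltgtP `|x i 0| `|x j 0|) => //= _.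
by case: (ltngtP i j) => // /val_inj e; rewrite e eqxx in ij.
Qed.

Lemma card_mag_rank_lt (x : 'cV[R]_n) s :
  (#|[set i | (mag_rank x i < s)%N]%SET| <= s)%N.
Proof.
case: s => [|s]; first by rewrite leqn0 cards_eq0; apply/eqP/finset.setP => i; rewrite !inE.
rewrite -[X in (_ <= X)%N]card_ord.
rewrite -(@card_in_imset _ _ (fun i => inord (mag_rank x i) : 'I_s.+1)).
  exact: max_card.
move=> i j; rewrite !inE => il jl /(congr1 (@nat_of_ord _)).
by rewrite !inordK//; exact: mag_rank_inj.
Qed.

Lemma tail_partE s (x : 'cV[R]_n) :
  tail_part s x = restr (~: [set i | (mag_rank x i < s)%N])%SET x.
Proof.
apply/colP => i; rewrite !mxE !inE; case: ifP => _ /=; by rewrite ?subrr ?subr0.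
Qed.

End LargestCoordinates.

(** * Scalar estimates *)

Section Scalars.
Context (R : realType).

(** By the arithmetic-geometric mean inequality,
P <= M / th + th * (2 * u + E) / 2 for every th > 0.  Moving the term th * u to
the left leaves the coefficient g = 1 + w / 10 - th of u.  The weight th must be
of order w for small w, so that the coefficient of E stays below 17/16 * w * g,
and bounded for large w, so that g stays away from 0; the choice
3/10 * w / (1 + w) does both, with g >= 5/6. *)
Lemma quadratic_head_bound (w E M u P : R) :
  0 < w -> 0 <= E -> 0 <= M -> 0 <= u ->
  (1 + w / 10) * u <= P + 9 / 10 * w * E ->
  P ^+ 2 <= 2 * M * (2 * u + E) ->
  u <= 17 / 16 * w * E + 4 * M * (1 + 1 / w).
Proof.
move=> w0 E0 M0 u0 lin quad.
pose th := 3 * w / (10 * (1 + w)).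
have w1 : 0 < 1 + w by lra.
have th0 : 0 < th by rewrite divr_gt0 ?mulr_gt0//; lra.
have thw : th * (1 + w) = 3 / 10 * w by rewrite /th; field; rewrite lt0r_neq0.
have Mth : M / th = 5 / 6 * (4 * M * (1 + 1 / w)).
  by rewrite /th; field; rewrite !lt0r_neq0.
clearbody th; pose g := 1 + w / 10 - th.
have g56 : 5 / 6 <= g.
  rewrite -(ler_pM2r w1) /g mulrBl thw -subr_ge0.
  have -> : (1 + w / 10) * (1 + w) - 3 / 10 * w - 5 / 6 * (1 + w) =
    (w - 1 / 6) ^+ 2 / 10 + 59 / 360 by field.
  by rewrite addr_ge0 ?divr_ge0 ?sqr_ge0.
have g0 : 0 < g by lra.
have amgm : P <= M / th + th * (2 * u + E) / 2.
  have r0 : 0 <= M / th + th * (2 * u + E) / 2.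
    by rewrite addr_ge0 ?divr_ge0 ?mulr_ge0//; lra.
  apply: le_trans (ler_norm _) _.
  rewrite -(@ler_pXn2r _ 2)// ?nnegrE// real_normK ?num_real//.
  apply: le_trans quad _; rewrite -subr_ge0.
  have -> : (M / th + th * (2 * u + E) / 2) ^+ 2 - 2 * M * (2 * u + E) =
    (M / th - th * (2 * u + E) / 2) ^+ 2.
    by field; rewrite lt0r_neq0.
  exact: sqr_ge0.
have coefM : M / th <= g * (4 * M * (1 + 1 / w)).
  rewrite Mth ler_wpM2r// !mulr_ge0// addr_ge0// divr_ge0//; lra.
have coefE : 9 / 10 * w + th / 2 <= g * (17 / 16 * w).
  rewrite -(ler_pM2r w1) /g.
  have -> : (9 / 10 * w + th / 2) * (1 + w) = 9 / 10 * w * (1 + w) + th * (1 + w) / 2.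
    by ring.
  have -> : (1 + w / 10 - th) * (17 / 16 * w) * (1 + w) =
    17 / 16 * w * ((1 + w / 10) * (1 + w) - th * (1 + w)) by ring.
  rewrite thw.
  have p : 0 <= w * ((w - 1 / 4) ^+ 2) by rewrite mulr_ge0 ?sqr_ge0// ltW.
  nra.
rewrite -(ler_pM2l g0) mulrDr.
have := ler_wpM2r E0 coefE; rewrite /g in coefM *; nra.
Qed.

(** The last hypothesis says b0 < 2.  As 2 < a forces 2 < q, it gives
16 * S < 89 * al, so that the term al in the denominator of a is at least a
ninth of S, and a falls below q by a definite factor. *)
Lemma par_a_le (q S al a : R) : 0 < q -> 0 < S -> 0 < al ->
  a * (S + al) = q * S - al -> 2 < a ->
  8 * (2 * (q * S) - al) < 2 * (17 * al * (2 * q + 1)) ->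
  10 * a <= 9 * q.
Proof.
move=> q0 S0 al0 ea a2 hb.
have q2 : 2 < q by rewrite -(ltr_pM2r S0); nra.
have Sal : 16 * S < 89 * al by rewrite -(ltr_pM2l q0); nra.
rewrite -(@ler_pM2r _ (S + al)); last lra.
rewrite -mulrA ea; nra.
Qed.

(** All that the conclusion uses of the vectors: H stands for norm2 (xhat - x),
u for the l2 norm of the head, N for the l1 norm off the leading support, P for
norm1 (A (xhat - x)), D and L for 1 + dub and 1 - dlb. *)
Lemma recovery_error_bound (q S al D L m eta sigma u H P N : R) :
  let a := (q * S - al) / (S + al) in
  let b0 := (8 * (2 * (q * S) - al)) / (17 * al * (2 * q + 1)) in
  let rho := L - D / a in
  let varrho := 1 / (2 * q) * ((17 * (2 * q + 1) * D) / (16 * a * rho) + 1) in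
  0 < q -> 0 < S -> 0 < al -> 0 <= D -> L <= D ->
  2 < a -> 1 < b0 -> a * b0 < a + b0 -> (b0 + 1) * D < a * b0 * L ->
  0 <= m -> 0 <= eta -> 0 <= sigma -> 0 <= u -> 0 <= H ->
  H <= u + N / (2 * (q * S)) ->
  L * u <= P + D * (N / (q * S)) ->
  P ^+ 2 <= m * (2 * eta * (S * u + N)) ->
  N <= S * u + (2 * sigma + al * H) ->
  H <= (S * varrho) / (S - al * varrho) * ((2 * sigma) / S) +
    (2 * (2 * q + 1) * (D + a * rho) * m * S ^+ 2) /
    (q * (S - al * varrho) * D * rho ^+ 2) * eta.
Proof.
move=> a b0 rho varrho q0 S0 al0 D0 LD a2 b1 ab hRIP m0 eta0 sg0 u0 H0 F1 F2 F3 cone.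
have Sal : 0 < S + al by lra.
have qS : 0 < q * S by rewrite mulr_gt0.
have q21 : 0 < 2 * q + 1 by lra.
have ea : a * (S + al) = q * S - al by rewrite /a; field; rewrite lt0r_neq0.
have d0 : 0 < 17 * al * (2 * q + 1) by rewrite !mulr_gt0//; lra.
have eb : b0 * (17 * al * (2 * q + 1)) = 8 * (2 * (q * S) - al).
  by rewrite /b0; field; rewrite !lt0r_neq0.
clearbody a b0.
have b2 : b0 < 2 by nra.
have aq : 10 * a <= 9 * q.
  apply: (@par_a_le q S al a) => //.
  by rewrite -eb ltr_pM2r.
have a0 : 0 < a by lra.
have b00 : 0 < b0 by lra.
have L0 : 0 < L.
  suff : 0 < a * b0 * L by rewrite pmulr_rgt0// mulr_gt0.
  by apply: le_lt_trans hRIP; rewrite mulr_ge0//; lra.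
have Dp : 0 < D by lra.
(* This is the isometry condition, rewritten as w < b0. *)
have rhob : D < b0 * (a * rho).
  have -> : b0 * (a * rho) = a * b0 * L - b0 * D.
    by rewrite /rho; field; rewrite lt0r_neq0.
  lra.
have rho0 : 0 < rho.
  have : 0 < b0 * a * rho by rewrite -mulrA; lra.
  by rewrite pmulr_rgt0// mulr_gt0.
have Lrho : L = rho + D / a by rewrite /rho subrK.
clearbody rho.
have arho : 0 < a * rho by rewrite mulr_gt0.
pose w := D / (a * rho).
have w0 : 0 < w by rewrite divr_gt0.
have wb : w < b0 by rewrite /w ltr_pdivrMr.
have vE : varrho = 1 / (2 * q) * (17 / 16 * (2 * q + 1) * w + 1).
  by rewrite /varrho /w; field; rewrite !lt0r_neq0.
(* At w = b0 the left side would be (q * S + al / 2) / (2 * q), and al < q * S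
because a is positive. *)
have vpos : al * varrho < S.
  have -> : al * varrho = (17 * al * (2 * q + 1) * w / 16 + al) / (2 * q).
    by rewrite vE; field; rewrite lt0r_neq0.
  rewrite ltr_pdivrMr; last lra.
  have : w * (17 * al * (2 * q + 1)) < b0 * (17 * al * (2 * q + 1)).
    by rewrite ltr_pM2r.
  rewrite eb; nra.
pose E := (2 * sigma + al * H) / S.
have E0 : 0 <= E by rewrite divr_ge0 ?addr_ge0 ?mulr_ge0//; lra.
have NE : N <= S * (u + E).
  apply: le_trans cone _; rewrite le_eqVlt; apply/orP; left; apply/eqP.
  by rewrite /E; field; rewrite lt0r_neq0.
pose M := m * eta * S / rho ^+ 2.
have M0 : 0 <= M by rewrite divr_ge0 ?sqr_ge0 ?mulr_ge0// ltW.
have headb : u <= 17 / 16 * w * E + 4 * M * (1 + 1 / w).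
  apply: (@quadratic_head_bound _ _ _ _ (P / rho)) => //.
    rewrite -(ler_pM2l rho0).
    have -> : rho * ((1 + w / 10) * u) = L * u - 9 / 10 * (D / a) * u.
      by rewrite Lrho /w; field; rewrite !lt0r_neq0.
    have -> : rho * (P / rho + 9 / 10 * w * E) = P + 9 / 10 * (D / a) * E.
      by rewrite /w; field; rewrite !lt0r_neq0.
    rewrite lerBlDr -addrA -mulrDr [E + u]addrC.
    apply: le_trans F2 _; rewrite lerD2l.
    apply: (@le_trans _ _ (D * ((u + E) / q))).
      have -> : (u + E) / q = S * (u + E) / (q * S) by field; rewrite !lt0r_neq0.
      by rewrite ler_wpM2l// ler_pM2r ?invr_gt0.
    have -> : 9 / 10 * (D / a) * (u + E) = D * (9 / 10 / a * (u + E)).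
      by field; rewrite lt0r_neq0.
    rewrite ler_wpM2l// mulrC ler_wpM2r ?addr_ge0//.
    rewrite ler_pdivlMr// mulrC ler_pdivrMr//; lra.
  rewrite expr_div_n ler_pdivrMr ?exprn_gt0//.
  have -> : 2 * M * (2 * u + E) * rho ^+ 2 = m * (2 * eta * (S * u + S * (u + E))).
    by rewrite /M; field; rewrite lt0r_neq0.
  apply: le_trans F3 _; rewrite ler_wpM2l// ler_wpM2l ?lerD2l//; lra.
have v0 : 0 < S - al * varrho by lra.
(* The part of the error due to the noise; the bound on H below is implicit,
since E contains H. *)
pose Y := (2 * q + 1) / (2 * q) * (4 * M * (1 + 1 / w)).
have HE : H <= varrho * E + Y.
  have : H <= (2 * q + 1) / (2 * q) * u + E / (2 * q).
    apply: le_trans F1 _.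
    have -> : (2 * q + 1) / (2 * q) * u + E / (2 * q) = u + (u + E) / (2 * q).
      by field; rewrite lt0r_neq0.
    rewrite lerD2l ler_pdivrMr; last lra.
    rewrite mulrAC.
    have -> : (u + E) * (2 * (q * S)) / (2 * q) = S * (u + E).
      by field; rewrite lt0r_neq0.
    by [].
  move/le_trans; apply.
  have -> : varrho * E + Y =
    (2 * q + 1) / (2 * q) * (17 / 16 * w * E + 4 * M * (1 + 1 / w)) + E / (2 * q).
    by rewrite vE /Y; field; rewrite !lt0r_neq0.
  by rewrite lerD2r ler_wpM2l// divr_ge0//; lra.
have -> : (S * varrho) / (S - al * varrho) * ((2 * sigma) / S) +
    (2 * (2 * q + 1) * (D + a * rho) * m * S ^+ 2) /
    (q * (S - al * varrho) * D * rho ^+ 2) * eta =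
    (2 * sigma * varrho + S * Y) / (S - al * varrho).
  by rewrite /Y /M /w; field; rewrite !lt0r_neq0.
rewrite ler_pdivlMr// mulrBr lerBlDr.
have : S * H <= S * (varrho * E + Y) by rewrite ler_pM2l.
have -> : S * (varrho * E + Y) = 2 * sigma * varrho + S * Y + H * (al * varrho).
  by rewrite /E; field; rewrite lt0r_neq0.
by rewrite mulrC.
Qed.

End Scalars.

(** * The recovery error *)

Section Recovery.
Context (R : realType) (m n : nat).

(** The l1 norm of xhat is at least that of x minus the mass of the difference on
T, plus its mass off T, up to twice the mass of x off T; the l2 terms differ by
at most norm2 (xhat - x). *)
Lemma l1_l2_cone (x xhat : 'cV[R]_n) (al : R) (T : {set 'I_n}) : 0 <= al ->
  norm1 xhat - al * norm2 xhat <= norm1 x - al * norm2 x ->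
  norm1 (restr (~: T) (xhat - x)) <= norm1 (restr T (xhat - x)) +
    (2 * norm1 (restr (~: T) x) + al * norm2 (xhat - x)).
Proof.
move=> al0 hmin.
have tri : norm2 xhat <= norm2 x + norm2 (xhat - x).
  by rewrite -[in leLHS](subrK x xhat) addrC norm2_triangle.
have split1 (v : 'cV[R]_n) : norm1 v = norm1 (restr T v) + norm1 (restr (~: T) v).
  by rewrite -[v in LHS]restr_setT (norm1_restr_split v (finset.subsetT T)) finset.setTD.
have onT : norm1 (restr T x) <= norm1 (restr T xhat) + norm1 (restr T (xhat - x)).
  rewrite !norm1_restr -big_split/=; apply: ler_sum => i _.
  rewrite !mxE -[X in `|X| <= _](subrK (xhat i 0)) addrC distrC.
  exact: ler_normD.
have offT : norm1 (restr (~: T) (xhat - x)) <=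
    norm1 (restr (~: T) xhat) + norm1 (restr (~: T) x).
  rewrite !norm1_restr -big_split/=; apply: ler_sum => i _.
  by rewrite !mxE ler_normB.
have := ler_wpM2l al0 tri; rewrite mulrDr => ht.
rewrite (split1 xhat) (split1 x) in hmin; lra.
Qed.

Lemma ds_residual (A : 'M[R]_(m, n)) (x xhat : 'cV[R]_n) (z b : 'cV[R]_m) (eta : R) :
  b = A *m x + z -> `|A^T *m z| <= eta -> ds_feasible A b eta xhat ->
  `|A^T *m (A *m (xhat - x))| <= 2 * eta.
Proof.
move=> hb hz hf.
have -> : A *m (xhat - x) = z - (b - A *m xhat).
  by rewrite hb mulmxBr opprB opprD addrCA [z + _]addrC subrK.
by rewrite mulmxBr (le_trans (ler_normB _ _))// mulrDl !mul1r lerD.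
Qed.

(** A unit coordinate vector is sparse for every order, and both isometry
inequalities apply to it.  Where the lower constant is below 1, this makes
1 + delta_ub positive, so that it can stand in a denominator. *)
Lemma rip_constants_compat (A : 'M[R]_(m, n)) r r' : (0 < n)%N ->
  (0 < r)%N -> (0 < r')%N ->
  0 <= 1 + delta_ub A r /\ 1 - delta_lb A r' <= 1 + delta_ub A r.
Proof.
move=> n0 r0 r0'.
have [e es e1] := sparse_unit R (Ordinal n0) (ltnSn 0).
have /(_ _ (leq_trans es r0)) := (delta_ub_least A n0 r0).1.
have /(_ _ (leq_trans es r0')) := (delta_lb_least A n0 r0').1.
rewrite e1 !mulr1 => lo up; split; last exact: le_trans lo up.
exact: le_trans (norm1_ge0 _) up.
Qed.

End Recovery.
Unset Implicit Arguments.
Set Strict Implicit.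

Theorem theorem3 (R : realType) (m n : nat) (hm : (0 < m)%N) (hmn : (m < n)%N)
    (A : 'M[R]_(m, n)) (x : 'cV[R]_n) (eta2 : R) (heta2 : 0 <= eta2)
    (z b : 'cV[R]_m) (hb : b = A *m x + z) (hz : `|A^T *m z| <= eta2)
    (s : nat) (hs : (1 <= s <= n)%N)
    (alpha : R) (halpha : 0 < alpha <= 1)
    (k : R) (hk : 0 < k)
    (ks : nat) (hks0 : (0 < ks)%N) (hks : k * s%:R = ks%:R)
    (xhat : 'cV[R]_n) (hxhat : ds_minimizer A b eta2 alpha xhat) :
  let a := par_a s%:R (k * s%:R) alpha in
  let b0 := par_b s%:R k alpha in
  let dub := delta_ub A ks in
  let dlb := delta_lb A (ks + s) in
  let rho := 1 - dlb - (1 + dub) / a in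
  let varrho := 1 / (2 * Num.sqrt k) *
    ((17 * (2 * Num.sqrt k + 1) * (1 + dub)) / (16 * a * rho) + 1) in
  2 < a ->
  1 < b0 ->
  a * b0 < a + b0 ->
  (b0 + 1) * dub + a * b0 * dlb < a * b0 - b0 - 1 ->
  norm2 (xhat - x) <=
    (Num.sqrt s%:R * varrho) / (Num.sqrt s%:R - alpha * varrho) *
      ((2 * norm1 (tail_part s x)) / Num.sqrt s%:R) +
    (2 * (2 * Num.sqrt k + 1) * ((1 + dub) + a * rho) * m%:R * s%:R) /
      (Num.sqrt k * (Num.sqrt s%:R - alpha * varrho) * (1 + dub) * rho ^+ 2) *
      eta2.
Proof.
move=> a b0 dub dlb rho varrho a2 b1 ab hRIP.
case/andP: hs => s1 sn; case/andP: halpha => al0 al1.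
have n0 : (0 < n)%N := leq_trans s1 sn.
have [feas opt] := hxhat.
have xfeas : ds_feasible A b eta2 x by rewrite /ds_feasible hb addrC addKr.
have ks1 : (0 < ks + s)%N by rewrite addn_gt0 hks0.
have [ubP _] := delta_ub_least A n0 hks0.
have [lbP _] := delta_lb_least A n0 ks1.
have [D0 LD] := rip_constants_compat A n0 hks0 ks1.
have s0 : 0 < s%:R :> R by rewrite ltr0n.
pose q := Num.sqrt k; pose S := Num.sqrt (s%:R : R).
have q0 : 0 < q by rewrite sqrtr_gt0.
have S0 : 0 < S by rewrite sqrtr_gt0.
have qS : Num.sqrt (k * s%:R) = q * S by rewrite sqrtrM// ltW.
pose h := xhat - x.
pose T := [set i | (mag_rank x i < s)%N]%SET.
have Ts : (#|T| <= s)%N := card_mag_rank_lt x s.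
have [B [BT Bc tail2 tailA]] := exists_head_small_tail hks0 D0 ubP (~: T) h.
rewrite -hks qS in tail2 tailA.
pose T01 := (T :|: B)%SET.
have TT01 : T \subset T01 by rewrite finset.subsetUl.
have T01C : (~: T01)%SET = (~: T :\: B)%SET.
  by apply/finset.setP => i; rewrite !inE negb_or andbC.
have T01c : (#|T01| <= ks + s)%N.
  by rewrite addnC (leq_trans (leq_card_setU _ _))// leq_add.
have hsplit : h = restr T01 h + restr (~: T :\: B) h by rewrite -T01C -restr_splitC.
have hT : norm1 (restr T h) <= S * norm2 (restr T01 h).
  apply: le_trans (sparse_norm1_le (sparse_restr h Ts)) _.
  by rewrite ler_wpM2l ?(ltW S0)// norm2_restr_subset.
have cone : norm1 (restr (~: T) h) <= S * norm2 (restr T01 h) +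
    (2 * norm1 (tail_part s x) + alpha * norm2 h).
  rewrite tail_partE (le_trans (l1_l2_cone T (ltW al0) (opt x xfeas)))//.
  by rewrite lerD2r.
have h1 : norm1 h <= S * norm2 (restr T01 h) + norm1 (restr (~: T) h).
  by rewrite [in leLHS](restr_splitC T h) (le_trans (norm1_triangle _ _))// lerD2r.
have quad : norm1 (A *m h) ^+ 2 <=
    m%:R * (2 * eta2 * (S * norm2 (restr T01 h) + norm1 (restr (~: T) h))).
  apply: (@le_trans _ _ (m%:R * norm2 (A *m h) ^+ 2)).
    rewrite -[X in X * _](@sqr_sqrtr _ m%:R)// -exprMn.
    by apply: lerXn2r; rewrite ?nnegrE ?mulr_ge0 ?sqrtr_ge0 ?norm1_ge0 ?norm2_ge0 ?norm1_le_sqrt_dim.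
  rewrite ler_wpM2l// (le_trans (norm2_mul_sqr_le A h))//.
  apply: ler_pM; rewrite ?norm1_ge0//.
  exact: ds_residual hb hz feas.
have lower : (1 - dlb) * norm2 (restr T01 h) <=
    norm1 (A *m h) + (1 + dub) * (norm1 (restr (~: T) h) / (q * S)).
  apply: le_trans (lbP _ (sparse_restr h T01c)) _.
  have -> : A *m restr T01 h = A *m h + - (A *m restr (~: T :\: B) h).
    by rewrite {2}hsplit mulmxDr addrK.
  by rewrite (le_trans (norm1_triangle _ _))// norm1N lerD2l.
have upper : norm2 h <= norm2 (restr T01 h) + norm1 (restr (~: T) h) / (2 * (q * S)).
  by rewrite {1}hsplit (le_trans (norm2_triangle _ _))// lerD2l.
have aE : a = (q * S - alpha) / (S + alpha) by rewrite /a /par_a qS.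
have b0E : b0 = (8 * (2 * (q * S) - alpha)) / (17 * alpha * (2 * q + 1)).
  by rewrite /b0 /par_b qS.
rewrite /varrho /rho aE; rewrite aE b0E in a2 b1 ab hRIP.
(* The factor s of the noise term has to appear as a square, but not the one
under the roots, which are folded into S before. *)
have sS : s%:R = S ^+ 2 by rewrite sqr_sqrtr// ltW.
rewrite -/S sS.
apply: (recovery_error_bound q0 S0 al0 D0 LD a2 b1 ab _ _ heta2 _ _ _ upper lower quad cone);
  rewrite ?ler0n ?norm1_ge0 ?norm2_ge0//.
move: hRIP; rewrite -/dlb -/dub; lra.
Qed.
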